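(* Let $L>0$ and $q\in(0,\infty)$. Let $\mu,\nu$ be two expected persistence measures on $\Omega$ with intensity functions $p_\mu$ and $p_\nu$ respectively. Then $$\mathsf{OT}_q^q(\mu,\nu)\;\le\;\frac{2}{(q+1)(q+2)}\left(\frac{L}{\sqrt2}\right)^{q+2}\|p_\mu-p_\nu\|_\infty .$$ Furthermore, there exist two sequences of expected persistence measures $\{\mu_n\}_{n\in\mathbb N}$ and $\{\nu_n\}_{n\in\mathbb N}$ on $\Omega$, with intensity functions $\{p_{\mu_n}\}_{n\in\mathbb N}$ and $\{p_{\nu_n}\}_{n\in\mathbb N}$ respectively, such that, as $n\to\infty$, $$\mathsf{OT}_q(\mu_n,\nu_n)\to 0\quad\text{while}\quad \|p_{\mu_n}-p_{\nu_n}\|_\infty\to\infty .$$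
   Context: $\Omega=\Omega(L)=\{(b,d): 0<b<d\le L\}\subset\mathbb R^2$, $\partial\Omega=\{(x,x):0\le x\le L\}$ and $\overline\Omega=\Omega\cup\partial\Omega$. A persistence diagram is a locally finite multiset of points $\{\bm r_i\}$ of $\Omega$, identified with the counting measure $\mu=\sum_i\delta_{\bm r_i}$ on $\Omega$ (its persistence measure). For a random persistence diagram, the expected persistence measure is the non-random measure $A\mapsto\mathbb E[\mu(A)]$ on Borel sets $A\subset\Omega$. Its intensity function, when it exists, is its density $p:\Omega\to\mathbb R_{\ge0}$ with respect to Lebesgue measure on $\Omega$. For Radon measures $\mu,\nu$, an admissible transport from $\mu$ to $\nu$ is a measure $\pi$ on $\overline\Omega\times\overline\Omega$ such that $\pi(A\times\overline\Omega)=\mu(A)$ and $\pi(\overline\Omega\times B)=\nu(B)$ for all Borel $A,B\subset\Omega$ (mass may be transported from and to the diagonal $\partial\Omega$ at will, so $\mu$ and $\nu$ may have different total masses). With $\mathsf{adm}(\mu,\nu)$ the set of admissible transports, $$\mathsf{OT}_q(\mu,\nu)=\Big(\inf_{\pi\in\mathsf{adm}(\mu,\nu)}\int_{\overline\Omega\times\overline\Omega}\|\bm x-\bm y\|_2^q\,\mathrm d\pi(\bm x,\bm y)\Big)^{1/q}.$$ For real-valued $f$ on $\Omega$, $\|f\|_\infty=\sup_{\bm x\in\Omega}|f(\bm x)|$. *)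

(* Defs.v *)
From mathcomp Require Import all_boot all_order all_algebra.
From mathcomp Require Import all_classical all_reals all_analysis.
From mathcomp Require Import measurable_realfun.

Set Implicit Arguments.
Unset Strict Implicit.
Unset Printing Implicit Defensive.

Import Order.TTheory GRing.Theory Num.Theory.
Import numFieldNormedType.Exports.

Local Open Scope classical_set_scope.
Local Open Scope ring_scope.

Definition Omega (R : realType) (L : R) : set (R * R) :=
  [set x | 0 < x.1 /\ x.1 < x.2 /\ x.2 <= L].

Definition dOmega (R : realType) (L : R) : set (R * R) :=
  [set x | x.1 = x.2 /\ 0 <= x.1 <= L].

(* Not the topological closure: the edge b = 0 is left out. *)
Definition cOmega (R : realType) (L : R) : set (R * R) :=
  Omega L `|` dOmega L.

(* The library norm on R * R is the max norm, hence this definition. *)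
Definition dist2 (R : realType) (x y : R * R) : R :=
  Num.sqrt ((x.1 - y.1) ^+ 2 + (x.2 - y.2) ^+ 2).

(* A locally finite multiset of points of Omega, encoded by its multiplicity
   function. Points may accumulate on the complement of Omega, in particular
   at the diagonal. *)
Record persistence_diagram (R : realType) (L : R) := PersistenceDiagram {
  mult :> R * R -> nat ;
  mult_supp : forall x, ~ Omega L x -> mult x = 0%N ;
  mult_locally_finite : forall x, Omega L x ->
    exists2 U, nbhs x U & finite_set (U `&` [set y | mult y <> 0%N]) }.

Definition persistence_measure (R : realType) (L : R)
    (D : persistence_diagram L) (A : set (R * R)) : \bar R :=
  \esum_(x in A) ((mult D x)%:R)%:E.

(* A random diagram is a random variable for the sigma-algebra generated by the
   evaluations D |-> persistence_measure D A. Measures on Omega are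
   represented by measures on R * R that vanish outside Omega; here this
   follows from mult_supp. *)
Definition expected_persistence_measure (R : realType) (L : R)
    (mu : {measure set (R * R) -> \bar R}) : Prop :=
  exists (d : measure_display) (T : measurableType d) (P : probability T R)
         (D : T -> persistence_diagram L),
    (forall A : set (R * R), measurable A ->
       measurable_fun [set: T] (fun w => persistence_measure (D w) A)) /\
    (forall A : set (R * R), measurable A ->
       mu A = (\int[P]_w persistence_measure (D w) A)%E).

(* Radon on Omega: only compact subsets of Omega are required to have finite
   mass. *)
Definition radon_on_Omega (R : realType) (L : R)
    (mu : {measure set (R * R) -> \bar R}) : Prop :=
  mu (~` Omega L) = 0%E /\
  forall K : set (R * R), compact K -> K `<=` Omega L -> (mu K < +oo)%E.

(* p is a version of the density of mu on Omega; its values outside Omega are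
   irrelevant. *)
Definition is_intensity (R : realType) (L : R)
    (mu : {measure set (R * R) -> \bar R}) (p : R * R -> R) : Prop :=
  [/\ forall x, Omega L x -> 0 <= p x,
      measurable_fun (Omega L) p &
      forall A : set (R * R), measurable A -> A `<=` Omega L ->
        mu A = (\int[lebesgue_measure \x lebesgue_measure]_(x in A)
                  (p x)%:E)%E].

(* The second coordinate (resp. first) ranges over all of cOmega, while the
   marginals are constrained on subsets of Omega only. *)
Definition admissible (R : realType) (L : R)
    (mu nu : {measure set (R * R) -> \bar R})
    (pi : {measure set ((R * R) * (R * R)) -> \bar R}) : Prop :=
  [/\ pi (~` (cOmega L `*` cOmega L)) = 0%E,
      forall A : set (R * R), measurable A -> A `<=` Omega L ->
        pi (A `*` cOmega L) = mu A &
      forall B : set (R * R), measurable B -> B `<=` Omega L ->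
        pi (cOmega L `*` B) = nu B].

Definition OT (R : realType) (L q : R)
    (mu nu : {measure set (R * R) -> \bar R}) : \bar R :=
  poweR (ereal_inf
    [set c | exists2 pi : {measure set ((R * R) * (R * R)) -> \bar R},
               admissible L mu nu pi &
               c = (\int[pi]_(z in cOmega L `*` cOmega L)
                      ((dist2 z.1 z.2 `^ q)%R)%:E)%E]) q^-1.

(* Pointwise supremum over Omega, as in the definition, not an essential
   supremum; +oo when f is unbounded. *)
Definition sup_norm (R : realType) (L : R) (f : R * R -> R) : \bar R :=
  ereal_sup [set (`|f x|)%:E | x in Omega L].

(* Main.v *)
Require Import Defs.
From HB Require Import structures.
From mathcomp Require Import all_boot all_order all_algebra.
From mathcomp Require Import all_classical all_reals all_analysis.
From mathcomp Require Import measurable_realfun.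
From mathcomp Require Import ring lra.
Import Order.TTheory GRing.Theory Num.Theory.
Import numFieldNormedType.Exports.
Local Open Scope classical_set_scope.
Local Open Scope ring_scope.
Set Implicit Arguments.
Unset Strict Implicit.
Unset Printing Implicit Defensive.

(* Upper bound: let the common part min(p_mu, p_nu) stay put, and match the
   excesses (p_mu - p_nu)^+ and (p_nu - p_mu)^+ with the diagonal along the
   orthogonal projection (b, d) |-> ((b + d)/2, (b + d)/2). The cost is the
   integral over Omega of |p_mu - p_nu| ((d - b) / sqrt 2)^q, and the integral
   of (d - b)^q over the triangle is L^(q+2) / ((q + 1)(q + 2)).

   Divergence: mu_n is the law of one point, uniform on a square of side
   e_n -> 0 lying within distance 3 e_n of the diagonal, and nu_n = 0. The same
   transport has cost at most (3 e_n)^q, while the mass 1 of the square forces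
   any version of the density difference to reach e_n^-2 in sup norm. *)

(** * Measures given by a density *)

Section density_measure.
Context d (T : measurableType d) (R : realType).
Variables (mu : {measure set T -> \bar R}) (f : T -> R).

(** The proofs [f0] and [mf] are arguments so that the term itself carries what its measure
    structure depends on. *)
Definition density_measure (f0 : forall x, 0 <= f x)
    (mf : measurable_fun [set: T] f) (A : set T) : \bar R :=
  (\int[mu]_(x in A) (f x)%:E)%E.

Hypotheses (f0 : forall x, 0 <= f x) (mf : measurable_fun [set: T] f).

Let density0 : density_measure f0 mf set0 = 0%E.
Proof. exact: integral_set0. Qed.

Let density_ge0 A : (0 <= density_measure f0 mf A)%E.
Proof. by apply: integral_ge0 => x _; rewrite lee_fin. Qed.

Let density_sigma_additive : semi_sigma_additive (density_measure f0 mf).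
Proof.
move=> F mF tF mUF; rewrite /density_measure; apply: cvg_toP.
  apply: ereal_nondecreasing_is_cvgn => m n mn.
  apply: lee_sum_nneg_natr => // k _ _.
  by apply: integral_ge0 => x _; rewrite lee_fin.
rewrite ge0_integral_bigcup//; first exact/measurable_EFinP/measurable_funTS.
by move=> x _; rewrite lee_fin.
Qed.

HB.instance Definition _ := isMeasure.Build _ _ _ (density_measure f0 mf)
  density0 density_ge0 density_sigma_additive.

(* [le_measure] only compares measurable sets. *)
Lemma le_density_measure A B : A `<=` B ->
  (density_measure f0 mf A <= density_measure f0 mf B)%E.
Proof.
move=> AB; rewrite /density_measure.
(* A nonnegative integral is a supremum over the simple functions below the restricted integrand;
   enlarging the set enlarges this family, measurable or not. *)
rewrite !ge0_integralE; try by move=> x _; rewrite lee_fin.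
apply: le_ereal_sup; apply: image_subset => h /= hA x.
apply: le_trans (hA x) _; rewrite !patchE.
case: ifPn => [/set_mem/AB/mem_set -> //|_].
by case: ifPn; rewrite lee_fin.
Qed.

Import HBNNSimple.

(** Monotone convergence along increasing simple approximations [g_ n] of [g] reduces the formula to
    simple functions, hence to indicators of their level sets. *)
Lemma ge0_integral_density_measure (g : T -> \bar R) :
  measurable_fun [set: T] g -> (forall x, (0 <= g x)%E) ->
  (\int[density_measure f0 mf]_x g x = \int[mu]_x (g x * (f x)%:E))%E.
Proof.
move=> mg g0; pose g_ := nnsfun_approx measurableT mg.
have g_cvg x : (fun n => (g_ n x)%:E) @ \oo --> g x by exact: cvg_nnsfun_approx.
have g_nd x : {homo (fun n => (g_ n x)%:E) : m n / (m <= n)%N >-> (m <= n)%E}.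
  by move=> m n mn; rewrite lee_fin; exact/lefP/nd_nnsfun_approx.
have mg_ n : measurable_fun [set: T] (EFin \o g_ n) by exact/measurable_EFinP.
have mEf : measurable_fun [set: T] (EFin \o f) by exact/measurable_EFinP.
transitivity (limn (fun n => \int[density_measure f0 mf]_x (g_ n x)%:E)%E).
  rewrite -monotone_convergence//=.
  - by apply: eq_integral => x _; apply/esym/cvg_lim.
  - by move=> n x _; rewrite lee_fin.
transitivity (limn (fun n => \int[mu]_x ((g_ n x)%:E * (f x)%:E))%E);
    last first.
  rewrite -monotone_convergence//=.
  - by apply: eq_integral => x _; apply/cvg_lim => //; exact: cvgeZr.
  - by move=> n; rewrite /=; apply/measurable_EFinP/measurable_funM.
  - by move=> n x _; rewrite mule_ge0// lee_fin.
  - by move=> x _ m n mn; rewrite lee_wpmul2r ?lee_fin//; exact: g_nd.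
congr (limn _); apply/funext => n.
have m1 y : measurable_fun [set: T]
    (fun x => (\1_(g_ n @^-1` [set y]) x)%:E : \bar R).
  by apply/measurable_EFinP/measurable_indic.
under [LHS]eq_integral do rewrite fimfunE -fsumEFin//.
rewrite ge0_integral_fsum//; last 2 first.
- by move=> y; exact/measurable_EFinP/measurable_funM.
- by move=> y x _; rewrite nnfun_muleindic_ge0.
under [RHS]eq_integral.
  move=> x _; rewrite fimfunE -fsumEFin// ge0_mule_fsuml; last first.
    by move=> y; rewrite nnfun_muleindic_ge0.
  over.
rewrite ge0_integral_fsum//; last 2 first.
- move=> y; apply: emeasurable_funM => //.
  exact/measurable_EFinP/measurable_funM.
- move=> y x _; rewrite mule_ge0 ?lee_fin// -lee_fin EFinM.
  exact: nnfun_muleindic_ge0.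
(* On the level set of a value y of [g_ n], both sides equal y times the integral of [f] over that
   set; writing y as [g_ n x] shows that it is nonnegative. *)
apply: eq_fsbigr => y /[!inE] -[x _ <-].
rewrite integralZl_indic_nnsfun// integral_indic// setIT.
under [RHS]eq_integral do rewrite EFinM -muleA.
rewrite ge0_integralZl//; [|exact: emeasurable_funM| |by rewrite lee_fin].
  congr (_ * _)%E; rewrite /= /density_measure integral_mkcond.
  apply: eq_integral => z _.
  by rewrite patchE indicE; case: ifPn => _; rewrite ?mul1e ?mul0e.
by move=> z _; rewrite mule_ge0 ?lee_fin.
Qed.

End density_measure.

(** * Lebesgue measure on the plane *)

Section lebesgue_plane.
Context {R : realType}.
Local Notation leb := (@lebesgue_measure R).

Let id_measurable :
  measurable_fun [set: measurableTypeR R * measurableTypeR R]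
    (id : measurableTypeR R * measurableTypeR R -> R * R).
Proof. by move=> _ A mA; rewrite setTI. Qed.

(* [leb \x leb] lives on [measurableTypeR R * measurableTypeR R], whose display
   differs from that of [R * R]; the push-forward by the identity changes the
   display and nothing else. *)
Definition lebesgue2 : {measure set (R * R) -> \bar R} :=
  measure_function_pushforward__canonical__measure_function_Measure
    (leb \x leb)%E id_measurable.

Lemma ge0_integral_lebesgue2 (A : set (R * R)) (f : R * R -> \bar R) :
  measurable A -> measurable_fun A f -> (forall x, A x -> (0 <= f x)%E) ->
  (\int[leb \x leb]_(x in A) f x = \int[lebesgue2]_(x in A) f x)%E.
Proof.
move=> mA mf f0.
rewrite (@ge0_integral_pushforward _ _ _ _ _ _ id_measurable)//.
by move=> x /set_mem; exact: f0.
Qed.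

Lemma lebesgue2_tonelli (f : R * R -> \bar R) :
  measurable_fun setT f -> (forall x, (0 <= f x)%E) ->
  (\int[lebesgue2]_x f x = \int[leb]_x \int[leb]_y f (x, y))%E.
Proof.
move=> mf f0.
by rewrite -ge0_integral_lebesgue2// fubini_tonelli1.
Qed.

Lemma lebesgue2_setX (A B : set R) : measurable A -> measurable B ->
  lebesgue2 (A `*` B) = (leb A * leb B)%E.
Proof. by move=> mA mB; exact: product_measure1E. Qed.

End lebesgue_plane.

(** * Integrals of powers of affine functions *)

Section integral_powR.
Context {R : realType}.
Local Notation leb := (@lebesgue_measure R).

(** [powR] has a default value at negative bases; the absolute value makes the power continuous on
    the whole line. Away from 0 this follows from differentiability, at 0 from a direct estimate. *)
Lemma continuous_powR_norm (r : R) : 0 < r ->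
  continuous (fun x : R => `|x| `^ r).
Proof.
move=> r0 x; have [->|x0] := eqVneq x 0; last first.
  apply: (@cvg_comp _ _ _ (fun x : R => `|x|) (fun x => x `^ r) _ (nbhs `|x|)).
    exact: norm_continuous.
  apply: (@differentiable_continuous _ _ _ (`|x|) (fun x => x `^ r)).
  apply/derivable1_diffP.
  by apply: derivable_powR; rewrite in_itv/= andbT normr_gt0.
rewrite /continuous_at normr0 powR0 ?gt_eqF//; apply/cvgr0Pnorm_lt => e e0.
(* The radius e^(1/r) is chosen so that |y| < e^(1/r) gives |y|^r < e. *)
apply: (filterS _ (@nbhs0_lt R R _ (powR_gt0 r^-1 e0))) => y ye.
rewrite ger0_norm ?powR_ge0//.
have -> : e = (e `^ r^-1) `^ r by rewrite -powRrM mulVf ?gt_eqF// powRr1// ltW.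
by rewrite gt0_ltr_powR// ?nnegrE ?powR_ge0//.
Qed.

(** Fundamental theorem of calculus with the primitive [F]. The slope [s] is 1 for the integral in d
    and -1 for the one in b; positivity is asked on the open interval only, because the affine
    function vanishes at an endpoint in both uses. *)
Lemma integral_powR_norm_affine (s t a b r : R) : a < b -> 0 < r -> s != 0 ->
  (forall x, x \in `]a, b[ -> 0 < s * x + t) ->
  (\int[leb]_(x in `[a, b]) (`|s * x + t| `^ r)%:E =
   ((`|s * b + t| `^ (r + 1) - `|s * a + t| `^ (r + 1)) / (s * (r + 1)))%:E)%E.
Proof.
move=> ab r0 s0 u0.
have r10 : 0 < r + 1 by rewrite addr_gt0.
have uC : continuous (fun x : R => s * x + t).
  move=> x; apply: cvgD; last exact: cvg_cst.
  by apply: cvgM; [exact: cvg_cst|exact: cvg_id].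
pose F (x : R) := (s * (r + 1))^-1 * `|s * x + t| `^ (r + 1).
have cN p : 0 < p -> continuous (fun x : R => `|s * x + t| `^ p).
  move=> p0 x; apply: (@continuous_comp _ _ _ (fun x => s * x + t)
    (fun x => `|x| `^ p)); [exact: uC|exact: continuous_powR_norm].
have cF : continuous F by move=> x; apply: cvgM; [exact: cvg_cst|exact: cN].
have dF x : x \in `]a, b[ -> is_derive x 1 F (`|s * x + t| `^ r).
  move=> /u0 ux.
  have dP : is_derive (s * x + t) 1 (fun x : R => x `^ (r + 1))
      ((r + 1) * (s * x + t) `^ (r + 1 - 1)) by exact: is_derive1_powR.
  have du : is_derive x 1 (fun y : R => s * y + t) s.
    apply: (is_derive_eq (is_deriveD (is_deriveZ s (is_derive_id x 1))
      (is_derive_cst t x 1))).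
    by rewrite addr0 scaler1.
  have dG := is_deriveZ (s * (r + 1))^-1 
    (@is_derive1_comp R _ (fun y : R => s * y + t) x _ _ dP du).
  (* The affine function stays positive near x, so the absolute value in [F] disappears locally. *)
  apply: near_eq_is_derive; last apply: (is_derive_eq dG).
    have : \forall y \near x, 0 < s * y + t by apply: (cvgr_gt _ (uC x)).
    by apply: filterS => y uy /=; rewrite /F gtr0_norm.
  by rewrite gtr0_norm// addrK /GRing.scale/=; field; rewrite s0 gt_eqF.
rewrite (@continuous_FTC2 _ _ F)//.
- by rewrite -EFinB /F -mulrBr mulrC.
- by apply: continuous_subspaceT; exact: cN.
- split.
  + by move=> x /dF [].
  + by apply: cvg_at_right_filter; exact: cF.
  + by apply: cvg_at_left_filter; exact: cF.
- by move=> x /dF [_ <-]; rewrite derive1E.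
Qed.
End integral_powR.

Lemma measurable_bool_set d (T : measurableType d) (b : T -> bool) :
  measurable_fun setT b -> measurable [set x | b x].
Proof. by move=> mb; have := mb measurableT [set true] I; rewrite setTI. Qed.

(** * Geometry of the triangle and the integral of a power of d - b over it *)

Section triangle.
Context {R : realType}.
Implicit Types (L q r : R) (x y : R * R).
Local Notation leb := (@lebesgue_measure R).

Lemma measurable_Omega L : measurable (Omega L).
Proof.
have -> : Omega L = [set x | (0 < x.1) && (x.1 < x.2) && (x.2 <= L)].
  apply/seteqP; split => x /=; first by move=> [-> [-> ->]].
  by move=> /andP[/andP[? ?] ?].
apply: measurable_bool_set.
apply: measurable_and; first apply: measurable_and.
- exact: measurable_fun_ltr.
- exact: measurable_fun_ltr.
- exact: measurable_fun_ler.
Qed.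

Lemma measurable_dOmega L : measurable (dOmega L).
Proof.
have -> : dOmega L = [set x | (x.1 == x.2) && (0 <= x.1) && (x.1 <= L)].
  apply/seteqP; split => x /=; first by
    move=> [e /andP[x0 xL]]; rewrite x0 xL e eqxx.
  by move=> /andP[/andP[/eqP e x0] xL]; split=> //; apply/andP.
apply: measurable_bool_set.
apply: measurable_and; first apply: measurable_and.
- exact: measurable_fun_eqr.
- exact: measurable_fun_ler.
- exact: measurable_fun_ler.
Qed.

Lemma measurable_cOmega L : measurable (cOmega L).
Proof.
by apply: measurableU; [exact: measurable_Omega|exact: measurable_dOmega].
Qed.

Lemma measurable_dist2 :
  measurable_fun setT (fun z : (R * R) * (R * R) => dist2 z.1 z.2).
Proof.
apply: measurableT_comp.
  exact: (continuous_measurable_fun (@sqrt_continuous R)).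
have m11 : measurable_fun setT (fun z : (R * R) * (R * R) => z.1.1).
  exact: measurableT_comp.
have m12 : measurable_fun setT (fun z : (R * R) * (R * R) => z.1.2).
  exact: measurableT_comp.
have m21 : measurable_fun setT (fun z : (R * R) * (R * R) => z.2.1).
  exact: measurableT_comp.
have m22 : measurable_fun setT (fun z : (R * R) * (R * R) => z.2.2).
  exact: measurableT_comp.
by apply: measurable_funD; apply: measurable_funX; apply: measurable_funB.
Qed.

Definition diag_proj x : R * R := ((x.1 + x.2) / 2, (x.1 + x.2) / 2).

Lemma measurable_diag_proj : measurable_fun setT diag_proj.
Proof.
have m : measurable_fun setT (fun x : R * R => (x.1 + x.2) / 2).
  by apply: measurable_funM => //; exact: measurable_funD.
exact: measurable_fun_pair.
Qed.

Lemma diag_proj_dOmega L x : Omega L x -> dOmega L (diag_proj x).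
Proof.
by move=> [x0 [x12 xL]]; split => //=; apply/andP; split; lra.
Qed.

Lemma dist2xx x : dist2 x x = 0.
Proof. by rewrite /dist2 !subrr expr0n addr0 sqrtr0. Qed.

Lemma dist2C x y : dist2 x y = dist2 y x.
Proof. by rewrite /dist2 -(sqrrN (x.1 - _)) -(sqrrN (x.2 - _)) !opprB. Qed.

Lemma dist2_diag_proj x : dist2 x (diag_proj x) = `|x.2 - x.1| / Num.sqrt 2.
Proof.
rewrite /dist2 /diag_proj /=.
have -> : (x.1 - (x.1 + x.2) / 2) ^+ 2 + (x.2 - (x.1 + x.2) / 2) ^+ 2 =
  (x.2 - x.1) ^+ 2 / 2 by field.
by rewrite sqrtrM ?sqr_ge0// sqrtr_sqr sqrtrV.
Qed.

(** By Tonelli: the integral of (d - b)^r over d in [b, L] is (L - b)^(r+1) / (r + 1), which is then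
    integrated over b in [0, L]. An upper bound suffices, so the slices may be enlarged to closed
    intervals. *)
Lemma integral_Omega_powR L r : 0 < L -> 0 < r ->
  (\int[lebesgue2]_(x in Omega L) (`|x.2 - x.1| `^ r)%:E <=
   (L `^ (r + 2) / ((r + 1) * (r + 2)))%:E)%E.
Proof.
move=> L0 r0.
have mf : measurable_fun setT
    (fun x : R * R => (`|x.2 - x.1| `^ r)%:E : \bar R).
  apply/measurable_EFinP; apply: (measurableT_comp (measurable_powR r)).
  by apply: measurableT_comp => //; exact: measurable_funB.
rewrite integral_mkcond lebesgue2_tonelli; last 2 first.
- apply/(measurable_restrictT _ _).1; first exact: measurable_Omega.
  exact: measurable_funTS.
- by move=> x; apply: erestrict_ge0 => y _; rewrite lee_fin powR_ge0.
have r10 : 0 < r + 1 by rewrite addr_gt0.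
pose F : R * R -> \bar R := (fun x => (`|x.2 - x.1| `^ r)%:E) \_ (Omega L).
pose I0L : set R := `[0, L]%classic.
(* Closed form of the inner integral, with L - b written as an affine function of slope -1. *)
pose G (b : R) : \bar R := ((r + 1)^-1 * `|-1 * b + L| `^ (r + 1))%:E.
have G0 b : (0 <= G b)%E by rewrite lee_fin mulr_ge0 ?powR_ge0// invr_ge0 ltW.
have mpow : measurable_fun setT
    (fun b : R => (`|-1 * b + L| `^ (r + 1))%:E : \bar R).
  apply/measurable_EFinP; apply: (measurableT_comp (measurable_powR (r + 1))).
  apply: measurableT_comp => //; apply: measurable_funD => //.
have mG : measurable_fun setT G.
  by rewrite /G; under eq_fun do rewrite EFinM; exact: emeasurable_funM.
have F0 x : (0 <= F x)%E.
  by apply: erestrict_ge0 => y _; rewrite lee_fin powR_ge0.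
have mF : measurable_fun setT F.
  apply/(measurable_restrictT _ _).1; first exact: measurable_Omega.
  exact: measurable_funTS.
(* The slice of [Omega L] at b is empty for b outside [0, L] and for b = L; otherwise it lies in
   [b, L]. *)
have inner b : (\int[leb]_d F (b, d) <= (G \_ I0L) b)%E.
  rewrite [leRHS]patchE; case: ifPn => [/set_mem/= bL|bL]; last first.
    rewrite integral0_eq// => d _; rewrite /F patchE memNset//.
    move=> -[/= b0 [bd dL]].
    move: bL; rewrite notin_setE /I0L/= in_itv/=; apply.
    by rewrite (ltW b0)/=; exact: (le_trans (ltW bd)).
  have [bL'|Lb] := ltP b L; last first.
    rewrite integral0_eq// => d _; rewrite /F patchE memNset//.
    move=> -[/= _ [bd dL]].
    by have := lt_le_trans bd (le_trans dL Lb); rewrite ltxx.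
  apply: (@le_trans _ _ (\int[leb]_(d in `[b, L]) (`|1 * d + - b| `^ r)%:E)%E).
    rewrite [leRHS]integral_mkcond; apply: ge0_le_integral => //.
    - exact/measurable_fun_pair2.
    - apply/(measurable_restrictT _ _).1 => //; apply: measurable_funTS.
      apply/measurable_EFinP; apply: (measurableT_comp (measurable_powR r)).
      apply: measurableT_comp => //; apply: measurable_funD => //.
    - move=> d _; rewrite /F !patchE mul1r.
      case: ifPn => [/set_mem/=[_ /= [bd dL]]|_].
        by rewrite mem_set//= in_itv/= (ltW bd).
      by case: ifPn => // _; rewrite lee_fin powR_ge0.
  rewrite integral_powR_norm_affine//; last first.
    by move=> x; rewrite in_itv/= => /andP[bx _]; rewrite mul1r subr_gt0.
  rewrite !mul1r subrr normr0 powR0 ?gt_eqF// subr0 lee_fin mulN1r.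
  by rewrite [L - b]addrC mulrC.
apply: (@le_trans _ _ (\int[leb]_b (G \_ I0L) b)%E).
  apply: ge0_le_integral => //.
  - by move=> b _; apply: integral_ge0.
  - exact: measurable_fun_fubini_tonelli_F.
  - apply/(measurable_restrictT _ _).1; first exact: measurable_itv.
    exact: measurable_funTS.
rewrite -integral_mkcond /G.
under eq_integral do rewrite EFinM.
rewrite ge0_integralZl//; last 3 first.
- exact: measurable_itv.
- exact: measurable_funTS.
- by rewrite lee_fin invr_ge0 ltW.
rewrite integral_powR_norm_affine//; last first.
  by move=> x; rewrite in_itv/= => /andP[_ xL]; rewrite mulN1r addrC subr_gt0.
rewrite -EFinM lee_fin.
rewrite mulr0 add0r mulN1r addNr normr0 powR0; last first.
  by rewrite gt_eqF// addr_gt0.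
rewrite gtr0_norm//.
have -> : r + 1 + 1 = r + 2 by ring.
have r20 : 0 < r + 2 by rewrite addr_gt0.
rewrite le_eqVlt; apply/orP; left; apply/eqP; field.
by rewrite !gt_eqF.
Qed.

End triangle.

(** * Transporting a density along a map *)

Section transport_plan.
Context {R : realType}.
Variables (L : R) (f : R * R -> R) (phi : R * R -> (R * R) * (R * R)).
Hypotheses (f0 : forall x, 0 <= f x) (mf : measurable_fun [set: R * R] f)
  (fO : forall x, ~ Omega L x -> f x = 0)
  (mphi : measurable_fun [set: R * R] phi)
  (phiO : forall x, Omega L x -> (cOmega L `*` cOmega L) (phi x)).

(** Image under [phi] of the measure with density [f]: a point x carries its mass from the first to
    the second component of [phi x]. Each piece of the transport plan has this form. *)
Definition moved_mass : {measure set ((R * R) * (R * R)) -> \bar R} :=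
  measure_function_pushforward__canonical__measure_function_Measure
    (density_measure lebesgue2 f0 mf) mphi.

Lemma moved_massE E :
  moved_mass E = (\int[lebesgue2]_(x in phi @^-1` E) (f x)%:E)%E.
Proof. by []. Qed.

Lemma moved_mass_support : moved_mass (~` (cOmega L `*` cOmega L)) = 0%E.
Proof.
rewrite moved_massE integral0_eq// => x /= nx.
by rewrite fO// => /phiO.
Qed.

(** Change of variables along [phi], then the density formula. The domains correspond because [phi]
    maps [Omega L] into the product and [f] vanishes elsewhere. *)
Lemma integral_moved_mass (c : (R * R) * (R * R) -> \bar R) :
  measurable_fun setT c -> (forall z, (0 <= c z)%E) ->
  (\int[moved_mass]_(z in cOmega L `*` cOmega L) c z =
   \int[lebesgue2]_(x in Omega L) (c (phi x) * (f x)%:E))%E.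
Proof.
move=> mc c0.
have mD : measurable (cOmega L `*` cOmega L).
  by apply: measurableX; exact: measurable_cOmega.
have mcD : measurable_fun setT (c \_ (cOmega L `*` cOmega L)).
  by apply/(measurable_restrictT _ _).1 => //; exact: measurable_funTS.
have cD0 z : (0 <= (c \_ (cOmega L `*` cOmega L)) z)%E by exact: erestrict_ge0.
rewrite integral_mkcond (ge0_integral_pushforward mphi)//.
have mcphi := measurableT_comp mcD mphi.
rewrite preimage_setT ge0_integral_density_measure//; last first.
  by move=> x; exact: cD0.
rewrite [RHS]integral_mkcond; apply: eq_integral => x _ /=.
rewrite !patchE; have [xO|xO] := pselect (Omega L x).
  by rewrite mem_set ?mem_set//; exact: phiO.
by rewrite fO// mule0 memNset.
Qed.

End transport_plan.

(** * The explicit plan, its marginals and its cost *)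

Section optimal_transport_bound.
Context {R : realType}.
Variables (L q : R) (mu nu : {measure set (R * R) -> \bar R}).
Variables (pmu pnu : R * R -> R).
Hypotheses (q0 : 0 < q) (mupmu : is_intensity L mu pmu)
  (nupnu : is_intensity L nu pnu).

(** Intensities are arbitrary outside [Omega L]; cutting them off there makes them nonnegative and
    measurable on the whole plane. *)
Let p1 : R * R -> R := pmu \_ (Omega L).
Let p2 : R * R -> R := pnu \_ (Omega L).

Let p1_ge0 x : 0 <= p1 x.
Proof.
by case: mupmu => p0 _ _; rewrite /p1 patchE; case: ifPn => // /set_mem/p0.
Qed.

Let p2_ge0 x : 0 <= p2 x.
Proof.
by case: nupnu => p0 _ _; rewrite /p2 patchE; case: ifPn => // /set_mem/p0.
Qed.

Let mp1 : measurable_fun setT p1.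
Proof.
case: mupmu => _ mp _; apply/(measurable_restrictT _ _).1 => //.
exact: measurable_Omega.
Qed.

Let mp2 : measurable_fun setT p2.
Proof.
case: nupnu => _ mp _; apply/(measurable_restrictT _ _).1 => //.
exact: measurable_Omega.
Qed.

Let p12 x := Num.min (p1 x) (p2 x).
Let e1 x := p1 x - p12 x.
Let e2 x := p2 x - p12 x.

Let p12_ge0 x : 0 <= p12 x.
Proof. by rewrite /p12 le_min p1_ge0 p2_ge0. Qed.

Let e1_ge0 x : 0 <= e1 x.
Proof. by rewrite /e1 subr_ge0 /p12 ge_min lexx. Qed.

Let e2_ge0 x : 0 <= e2 x.
Proof. by rewrite /e2 subr_ge0 /p12 ge_min lexx orbT. Qed.

Let mp12 : measurable_fun setT p12. Proof. exact: measurable_minr. Qed.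
Let me1 : measurable_fun setT e1. Proof. exact: measurable_funB. Qed.
Let me2 : measurable_fun setT e2. Proof. exact: measurable_funB. Qed.

Let p1O x : ~ Omega L x -> p1 x = 0.
Proof. by move=> xO; rewrite /p1 patchE memNset. Qed.
Let p2O x : ~ Omega L x -> p2 x = 0.
Proof. by move=> xO; rewrite /p2 patchE memNset. Qed.
Let p12O x : ~ Omega L x -> p12 x = 0.
Proof. by move=> xO; rewrite /p12 p1O// p2O// minxx. Qed.
Let e1O x : ~ Omega L x -> e1 x = 0.
Proof. by move=> xO; rewrite /e1 p1O// p12O// subr0. Qed.
Let e2O x : ~ Omega L x -> e2 x = 0.
Proof. by move=> xO; rewrite /e2 p2O// p12O// subr0. Qed.

Let stay (x : R * R) := (x, x).
Let leave (x : R * R) := (x, diag_proj x).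
Let enter (x : R * R) := (diag_proj x, x).

Let mstay : measurable_fun setT stay.
Proof. exact: measurable_fun_pair. Qed.
Let mleave : measurable_fun setT leave.
Proof. by apply: measurable_fun_pair => //; exact: measurable_diag_proj. Qed.
Let menter : measurable_fun setT enter.
Proof. by apply: measurable_fun_pair => //; exact: measurable_diag_proj. Qed.

Let stayO x : Omega L x -> (cOmega L `*` cOmega L) (stay x).
Proof. by move=> xO; split; left. Qed.
Let leaveO x : Omega L x -> (cOmega L `*` cOmega L) (leave x).
Proof. by move=> xO; split; [left|right; exact: diag_proj_dOmega]. Qed.
Let enterO x : Omega L x -> (cOmega L `*` cOmega L) (enter x).
Proof. by move=> xO; split; [right; exact: diag_proj_dOmega|left]. Qed.

(* The common part [min p1 p2] stays put and the two excesses are matched with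
   the diagonal along the orthogonal projection. *)
Let plan : {measure set ((R * R) * (R * R)) -> \bar R} :=
  measure_add (moved_mass p12_ge0 mp12 mstay)
    (measure_add (moved_mass e1_ge0 me1 mleave) (moved_mass e2_ge0 me2 menter)).

Let planE E : (plan E = moved_mass p12_ge0 mp12 mstay E +
  (moved_mass e1_ge0 me1 mleave E + moved_mass e2_ge0 me2 menter E))%E.
Proof.
apply: (etrans (measure_addE _ _ _)); congr (_ + _)%E; exact: measure_addE.
Qed.

(** Projections lie on the diagonal, where b < d fails. Hence the marginals on [Omega L] do not see
    the mass deposited on or taken from the diagonal. *)
Let diag_proj_notin (A : set (R * R)) : A `<=` Omega L ->
  diag_proj @^-1` A = set0.
Proof.
move=> AO; apply/seteqP; split => x //= /AO [_ [/=]]; by rewrite ltxx.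
Qed.

Let integral_excess (A : set (R * R)) (p e : R * R -> R) : measurable A ->
  measurable_fun setT e -> (forall x, 0 <= e x) ->
  (forall x, p12 x + e x = p x) ->
  (\int[lebesgue2]_(x in A) (p12 x)%:E + \int[lebesgue2]_(x in A) (e x)%:E =
   \int[lebesgue2]_(x in A) (p x)%:E)%E.
Proof.
move=> mA me e_ge0 pe.
rewrite -ge0_integralD//; last 4 first.
- by move=> x _; rewrite lee_fin.
- by apply/measurable_EFinP; exact: measurable_funTS.
- by move=> x _; rewrite lee_fin.
- by apply/measurable_EFinP; exact: measurable_funTS.
by apply: eq_integral => x _; rewrite -EFinD pe.
Qed.

Let integral_restricted (A : set (R * R))
    (m : {measure set (R * R) -> \bar R}) (p : R * R -> R) :
  measurable A -> A `<=` Omega L ->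
  is_intensity L m p ->
  (\int[lebesgue2]_(x in A) ((p \_ (Omega L)) x)%:E = m A)%E.
Proof.
move=> mA AO [p0 mp ->//].
rewrite ge0_integral_lebesgue2//.
- apply: eq_integral => x /set_mem/AO xO.
  by rewrite patchE mem_set.
- apply/measurable_EFinP; apply: measurable_funS mp => //.
  exact: measurable_Omega.
- by move=> x /AO/p0; rewrite lee_fin.
Qed.

(** Over a set A in the first coordinate, [stay] and [leave] contribute [p12] and [e1], whose sum is
    [p1], while [enter] starts on the diagonal and contributes nothing. The second marginal is
    symmetric, with [e2] and [p2]. *)
Let plan_admissible : admissible L mu nu plan.
Proof.
split.
- by rewrite planE !(@moved_mass_support _ L)// !adde0.
- move=> A mA AO; rewrite planE !moved_massE.
  have -> : stay @^-1` (A `*` cOmega L) = A.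
    by apply/seteqP; split => [x []|x Ax]//=; split => //; left; exact: AO.
  have -> : leave @^-1` (A `*` cOmega L) = A.
    apply/seteqP; split => [x []|x Ax]//=; split => //; right.
    exact/diag_proj_dOmega/AO.
  have -> : enter @^-1` (A `*` cOmega L) = set0.
    rewrite -subset0 => x [/= xA _]; have : (diag_proj @^-1` A) x by [].
    by rewrite diag_proj_notin.
  rewrite integral_set0 adde0 -(integral_restricted mA AO mupmu).
  by apply: integral_excess => // x; rewrite /e1 addrC subrK.
- move=> A mA AO; rewrite planE !moved_massE.
  have -> : stay @^-1` (cOmega L `*` A) = A.
    by apply/seteqP; split => [x []|x Ax]//=; split => //; left; exact: AO.
  have -> : enter @^-1` (cOmega L `*` A) = A.
    apply/seteqP; split => [x []|x Ax]//=; split => //; right.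
    exact/diag_proj_dOmega/AO.
  have -> : leave @^-1` (cOmega L `*` A) = set0.
    rewrite -subset0 => x [/= _ xA]; have : (diag_proj @^-1` A) x by [].
    by rewrite diag_proj_notin.
  rewrite integral_set0 add0e -(integral_restricted mA AO nupnu).
  by apply: integral_excess => // x; rewrite /e2 addrC subrK.
Qed.

Let cost (z : (R * R) * (R * R)) : \bar R := (dist2 z.1 z.2 `^ q)%:E.

Let cost_ge0 z : (0 <= cost z)%E.
Proof. by rewrite lee_fin powR_ge0. Qed.

Let mcost : measurable_fun setT cost.
Proof.
apply/measurable_EFinP; apply: (measurableT_comp (measurable_powR q)).
exact: measurable_dist2.
Qed.

Let plan_cost :
  (\int[plan]_(z in cOmega L `*` cOmega L) cost z =
   \int[lebesgue2]_(x in Omega L)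
     (`|pmu x - pnu x| * dist2 x (diag_proj x) `^ q)%:E)%E.
Proof.
have mD : measurable (cOmega L `*` cOmega L).
  by apply: measurableX; exact: measurable_cOmega.
have mcD : measurable_fun (cOmega L `*` cOmega L) cost.
  exact: measurable_funTS.
rewrite /plan 2?ge0_integral_measure_add//.
rewrite !integral_moved_mass//.
(* Mass that stays put costs 0^q, which is 0 since q > 0. *)
rewrite [X in (X + _)%E]integral0_eq ?add0e; last first.
  by move=> x _; rewrite /cost/= dist2xx powR0 ?mul0e// gt_eqF.
have mterm (g : R * R -> (R * R) * (R * R)) e :
    measurable_fun setT g -> measurable_fun setT e ->
    measurable_fun (Omega L) (fun x => (cost (g x) * (e x)%:E)%E).
  move=> mg me; apply: measurable_funTS; apply: emeasurable_funM.
    exact: measurableT_comp.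
  exact/measurable_EFinP.
rewrite -ge0_integralD//; last 5 first.
- exact: measurable_Omega.
- by move=> x _; rewrite mule_ge0// lee_fin.
- exact: mterm.
- by move=> x _; rewrite mule_ge0// lee_fin.
- exact: mterm.
apply: eq_integral => x /set_mem xO.
rewrite /cost/= (dist2C (diag_proj x)) -!EFinM -EFinD; congr EFin.
rewrite -mulrDr mulrC; congr (_ * _).
rewrite /e1 /e2 /p12 /p1 /p2 !patchE mem_set//.
(* At each point one of the two excesses vanishes and the other is the absolute difference. *)
by case: (lerP (pmu x) (pnu x)) => h; rewrite subrr ?addr0 ?add0r//.
Qed.

Lemma poweR_OT_le : (poweR (OT L q mu nu) q <=
  \int[lebesgue2]_(x in Omega L)
     (`|pmu x - pnu x| * dist2 x (diag_proj x) `^ q)%:E)%E.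
Proof.
rewrite /OT; set S := [set c | _].
have S0 : (0 <= ereal_inf S)%E.
  apply/ereal_infP => _ [pi _ ->]; apply: integral_ge0 => z _.
  by rewrite lee_fin powR_ge0.
(* The infimum is nonnegative, so the power q undoes the power 1/q; any admissible plan then bounds
   it. *)
rewrite -poweRrM mulVf ?gt_eqF// poweRe1//.
apply: ereal_inf_lbound; exists plan; first exact: plan_admissible.
by rewrite -plan_cost.
Qed.

End optimal_transport_bound.

(** * The upper bound by the sup norm *)

Section sup_norm_bound.
Context {R : realType}.
Implicit Types (L q : R) (x : R * R) (f : R * R -> R).

Lemma sup_norm_ubound L f x : Omega L x -> (`|f x|%:E <= sup_norm L f)%E.
Proof. by move=> xO; apply: ereal_sup_ubound; exists x. Qed.

(** A point of [Omega L] is needed, since an empty supremum is -oo; (L/2, L) is one. *)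
Lemma sup_norm_ge0 L f : 0 < L -> (0 <= sup_norm L f)%E.
Proof.
move=> L0; apply: (@le_trans _ _ (`|f (L / 2, L)|%:E)).
  by rewrite lee_fin.
apply: sup_norm_ubound; split => /=; first by rewrite divr_gt0.
by split => //; lra.
Qed.

Lemma dist2_diag_proj_powR q x :
  dist2 x (diag_proj x) `^ q = (Num.sqrt 2)^-1 `^ q * `|x.2 - x.1| `^ q.
Proof.
by rewrite dist2_diag_proj powRM// ?invr_ge0 ?sqrtr_ge0// mulrC.
Qed.

Lemma integral_Omega_dist2_diag_proj L q : 0 < L -> 0 < q ->
  (\int[lebesgue2]_(x in Omega L) (dist2 x (diag_proj x) `^ q)%:E <=
   (2 / ((q + 1) * (q + 2)) * (L / Num.sqrt 2) `^ (q + 2))%:E)%E.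
Proof.
move=> L0 q0.
have k0 : 0 <= (Num.sqrt 2)^-1 :> R by rewrite invr_ge0 sqrtr_ge0.
have kN0 : (Num.sqrt 2)^-1 != 0 :> R by rewrite invr_eq0 sqrtr_eq0 -ltNge.
under eq_integral do rewrite dist2_diag_proj_powR EFinM.
rewrite ge0_integralZl//; last 2 first.
- exact: measurable_Omega.
- apply/measurable_EFinP; apply: measurable_funTS.
  apply: (measurableT_comp (measurable_powR q)).
  by apply: measurableT_comp => //; exact: measurable_funB.
apply: (le_trans (lee_pmul _ _ (lexx _) (integral_Omega_powR L0 q0))).
- by rewrite lee_fin powR_ge0.
- by apply: integral_ge0 => x _; rewrite lee_fin powR_ge0.
(* The factor 2 of the constant arises here: (1/sqrt 2)^q = 2 (1/sqrt 2)^(q+2). *)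
rewrite -EFinM lee_fin powRM ?(ltW L0)// [_^-1 `^ (q + 2)]powRD ?kN0 ?implybT//.
rewrite powR_mulrn// exprVn sqr_sqrtr// le_eqVlt; apply/orP; left; apply/eqP.
by field; rewrite !gt_eqF ?addr_gt0.
Qed.

Lemma measurable_dist2_diag_proj q :
  measurable_fun setT (fun x : R * R => dist2 x (diag_proj x) `^ q).
Proof.
apply: (measurableT_comp (measurable_powR q)).
apply: (measurableT_comp (g := fun x : R * R => (x, diag_proj x))
  (@measurable_dist2 R)).
by apply: measurable_fun_pair => //; exact: measurable_diag_proj.
Qed.

Lemma poweR_OT_le_sup_norm L q (mu nu : {measure set (R * R) -> \bar R})
    (pmu pnu : R * R -> R) : 0 < L -> 0 < q ->
  is_intensity L mu pmu -> is_intensity L nu pnu ->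
  (poweR (OT L q mu nu) q <=
     (2 / ((q + 1) * (q + 2)) * (L / Num.sqrt 2) `^ (q + 2))%:E *
     sup_norm L (fun x => (pmu x - pnu x)%R))%E.
Proof.
move=> L0 q0 mup nup; apply: (le_trans (poweR_OT_le q0 mup nup)).
(* Strict positivity makes the right-hand side +oo when the sup norm is infinite. *)
have C0 : 0 < 2 / ((q + 1) * (q + 2)) * (L / Num.sqrt 2) `^ (q + 2).
  rewrite mulr_gt0// ?divr_gt0 ?mulr_gt0 ?addr_gt0 ?powR_gt0//.
  by rewrite divr_gt0 ?sqrtr_gt0.
have := sup_norm_ge0 (fun x => pmu x - pnu x) L0.
have := @sup_norm_ubound L (fun x => pmu x - pnu x).
case: (sup_norm _ _) => [S|_ _|//]; last by rewrite gt0_muley ?leey ?lte_fin.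
move=> le_S S0.
have [[_ mpmu _] [_ mpnu _]] := (mup, nup).
have mdist := measurable_dist2_diag_proj q.
apply: (@le_trans _ _ (\int[lebesgue2]_(x in Omega L)
    (S%:E * (dist2 x (diag_proj x) `^ q)%:E))%E).
  apply: ge0_le_integral => //.
  - exact: measurable_Omega.
  - by move=> x _; rewrite lee_fin mulr_ge0// powR_ge0.
  - apply/measurable_EFinP; apply: measurable_funM;
      last exact: measurable_funTS.
    by apply: measurableT_comp => //; exact: measurable_funB.
  - apply/measurable_EFinP/measurable_funM => //; exact: measurable_funTS.
  - move=> x xO; rewrite -EFinM lee_fin ler_wpM2r ?powR_ge0//.
    by rewrite -lee_fin; exact: le_S.
rewrite ge0_integralZl//; last 3 first.
- exact: measurable_Omega.
- by apply/measurable_EFinP; exact: measurable_funTS.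
- by move=> x _; rewrite lee_fin powR_ge0.
by rewrite [leRHS]muleC lee_wpmul2l//; exact: integral_Omega_dist2_diag_proj.
Qed.

End sup_norm_bound.

(** * Random diagrams with at most one point *)

Section one_point_diagrams.
Context {R : realType}.
Variable L : R.

Definition empty_diagram : persistence_diagram L.
Proof.
refine (@PersistenceDiagram R L (fun=> 0%N) (fun _ _ => erefl) _).
move=> x xO; exists setT; first exact: filterT.
by apply: (@sub_finite_set _ _ set0) => // y [].
Defined.

Lemma empty_diagram_measure A : persistence_measure empty_diagram A = 0%E.
Proof. by apply: esum1. Qed.

(** A point w outside [Omega L] yields the empty diagram, so that every w in the plane defines a
    diagram. *)
Definition single_mult (w x : R * R) : nat := ((x == w) && (w \in Omega L)).

Definition single_diagram (w : R * R) : persistence_diagram L.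
Proof.
refine (@PersistenceDiagram R L (single_mult w) _ _).
- move=> x xO; rewrite /single_mult; case: eqP => //= <-.
  by rewrite memNset.
- move=> x xO; exists setT; first exact: filterT.
  apply: (@sub_finite_set _ _ [set w]) => // y [_ /=].
  by rewrite /single_mult; case: eqP.
Defined.

Lemma single_diagram_measure w A :
  persistence_measure (single_diagram w) A = (\1_(A `&` Omega L) w)%:E.
Proof.
rewrite /persistence_measure /= indicE in_setI.
have [wA|wA] := boolP (w \in A).
  transitivity (\esum_(x in [set w]) ((single_mult w x)%:R%:E : \bar R)).
    have -> : [set w] = A `&` [set w].
      by apply/seteqP; split => [x ->|x []//]; split => //; exact: set_mem.
    rewrite esum_mkcondr; apply: eq_esum => x xA.
    case: ifPn => // /negP xw; rewrite /single_mult; case: eqP => //= e.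
    by exfalso; apply: xw; rewrite e mem_set.
  by rewrite esum_set1 ?lee_fin// /single_mult eqxx.
rewrite esum1// => x xA; rewrite /single_mult; case: eqP => //= xw.
by move: wA; rewrite -xw mem_set.
Qed.

(** The sample space is the plane with law [P], and w is sent to its one-point diagram. The expected
    mass of A is then P of A intersected with [Omega L], which is P of A. *)
Lemma expected_persistence_measure_probability
    (P : probability (R * R)%type R) :
  P (~` Omega L) = 0%E -> expected_persistence_measure L P.
Proof.
move=> PO; exists _, (R * R)%type, P, single_diagram.
split=> A mA.
  under eq_fun do rewrite single_diagram_measure.
  apply/measurable_EFinP/measurable_indic/measurableI => //.
  exact: measurable_Omega.
under eq_integral do rewrite single_diagram_measure.
rewrite integral_indic//; last first.
  by apply: measurableI => //; exact: measurable_Omega.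
rewrite setIT (measureDI P mA (measurable_Omega L)).
rewrite [X in (X + _)%E](_ : _ = 0%E) ?add0e//.
apply/eqP; rewrite eq_le measure_ge0 andbT -PO; apply: le_measure.
- by rewrite inE; apply: measurableD => //; exact: measurable_Omega.
- by rewrite inE; apply: measurableC; exact: measurable_Omega.
- by move=> x [].
Qed.

Lemma expected_persistence_measure_mzero :
  expected_persistence_measure L (@mzero _ (R * R)%type R).
Proof.
(* The diagram is constant, so any probability space serves; the Dirac mass is an arbitrary
   choice. *)
exists _, (R * R)%type, (@dirac _ (R * R)%type (0, 0) R), (fun=> empty_diagram).
split=> A mA.
  under eq_fun do rewrite empty_diagram_measure.
  exact: measurable_cst.
by rewrite integral0_eq// => w _; rewrite empty_diagram_measure.
Qed.

Lemma radon_on_Omega_mzero : radon_on_Omega L (@mzero _ (R * R)%type R).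
Proof. by split=> // K _ _; rewrite /= /mzero ltry. Qed.

Lemma is_intensity_mzero : is_intensity L (@mzero _ (R * R)%type R) (cst 0).
Proof. by split => // A mA AO; rewrite integral0_eq. Qed.

End one_point_diagrams.

(** * The uniform law on a small square near the diagonal *)

Section uniform_square.
Context {R : realType}.
Variables (L e : R).
Hypotheses (e0 : 0 < e) (eL : e <= L / 8).

(** On this square d - b lies between e and 3e, which keeps it off the diagonal yet close to it;
    with e <= L/8 its top L/2 + 3e stays below L. *)
Definition square : set (R * R) :=
  `[L / 2, L / 2 + e]%classic `*` `[L / 2 + 2 * e, L / 2 + 3 * e]%classic.

Lemma measurable_square : measurable square.
Proof. by apply: measurableX; exact: measurable_itv. Qed.

Lemma lebesgue2_square : lebesgue2 square = (e ^+ 2)%:E.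
Proof.
have e0' := e0.
rewrite lebesgue2_setX; [|exact: measurable_itv|exact: measurable_itv].
rewrite !lebesgue_measure_itv /= !lte_fin.
have -> : L / 2 < L / 2 + e by lra.
have -> : L / 2 + 2 * e < L / 2 + 3 * e by lra.
by rewrite -!EFinB -EFinM; congr EFin; ring.
Qed.

Lemma square_Omega : square `<=` Omega L.
Proof.
have [e0' eL'] := (e0, eL).
move=> x; rewrite /square/= !in_itv/= => -[/andP[? ?] /andP[? ?]].
by rewrite /Omega/=; split; [lra|split; lra].
Qed.

Lemma square_dist2 x : square x -> dist2 x (diag_proj x) <= 3 * e.
Proof.
have e0' := e0; rewrite /square/= !in_itv/= => -[/andP[? ?] /andP[? ?]].
rewrite dist2_diag_proj ler_pdivrMr ?sqrtr_gt0//.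
have s1 : 1 <= Num.sqrt 2 :> R by rewrite -[leLHS]sqrtr1 ler_sqrt; lra.
rewrite ger0_norm; last lra.
by apply: (@le_trans _ _ (3 * e)); [lra|rewrite ler_peMr//; lra].
Qed.

Definition square_pdf (x : R * R) : R := e ^- 2 * \1_square x.

Lemma square_pdf_ge0 x : 0 <= square_pdf x.
Proof. by rewrite mulr_ge0// invr_ge0 sqr_ge0. Qed.

Lemma measurable_square_pdf : measurable_fun setT square_pdf.
Proof.
apply: measurable_funM => //; apply: measurable_indic.
exact: measurable_square.
Qed.

(** The term carries the proof of 0 < e, on which the probability structure depends: total mass 1
    requires a nonzero area. *)
Definition uniform_square (_ : 0 < e) : set (R * R) -> \bar R :=
  density_measure lebesgue2 square_pdf_ge0 measurable_square_pdf.

HB.instance Definition _ := Measure.on (uniform_square e0).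

Let uniform_square_setT : uniform_square e0 [set: R * R] = 1%E.
Proof.
rewrite /uniform_square /density_measure /square_pdf.
under eq_integral do rewrite EFinM.
rewrite ge0_integralZl//; last 2 first.
- by apply/measurable_EFinP; apply: measurable_indic; exact: measurable_square.
- by rewrite lee_fin invr_ge0 sqr_ge0.
rewrite integral_indic//; last exact: measurable_square.
by rewrite setIT lebesgue2_square -EFinM mulVf// sqrf_eq0 gt_eqF.
Qed.

Let uniform_square_square : uniform_square e0 square = 1%E.
Proof.
rewrite -uniform_square_setT /uniform_square /density_measure.
rewrite integral_mkcond; apply: eq_integral => x _.
rewrite patchE /square_pdf indicE; case: ifPn => [->//|_ /=].
by rewrite mulr0.
Qed.

HB.instance Definition _ := @Measure_isProbability.Build _ _ R
  (uniform_square e0) uniform_square_setT.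

Lemma uniform_square_OmegaC : uniform_square e0 (~` Omega L) = 0%E.
Proof.
rewrite /uniform_square /density_measure integral0_eq// => x xO.
by rewrite /square_pdf indicE memNset ?mulr0// => /square_Omega.
Qed.

Lemma radon_on_Omega_uniform_square : radon_on_Omega L (uniform_square e0).
Proof.
split=> [|K _ _]; first exact: uniform_square_OmegaC.
apply: (@le_lt_trans _ _ (uniform_square e0 [set: R * R])).
  exact: le_density_measure.
by rewrite uniform_square_setT ltry.
Qed.

Lemma is_intensity_uniform_square :
  is_intensity L (uniform_square e0) square_pdf.
Proof.
split.
- by move=> x _; exact: square_pdf_ge0.
- exact: measurable_funTS measurable_square_pdf.
- move=> A mA AO; rewrite ge0_integral_lebesgue2//.
    by apply/measurable_EFinP/measurable_funTS; exact: measurable_square_pdf.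
  by move=> x _; rewrite lee_fin square_pdf_ge0.
Qed.

(** Ensures that the sup norms of the exhibited densities are finite, so that their divergence is
    not caused by infinite terms. *)
Lemma sup_norm_square_pdf :
  (sup_norm L (fun x => (square_pdf x - 0)%R) <= (e ^- 2)%:E)%E.
Proof.
apply/ereal_supP => _ [x xO <-].
rewrite lee_fin subr0 ger0_norm ?square_pdf_ge0//.
by rewrite /square_pdf ler_piMr// invr_ge0 sqr_ge0.
Qed.

Lemma OT_uniform_square q : 0 < q ->
  (OT L q (uniform_square e0) (@mzero _ (R * R)%type R) <= (3 * e)%:E)%E.
Proof.
move=> q0.
have e30 : 0 <= 3 * e by rewrite mulr_ge0// ltW.
(* The plan controls the q-th power of the distance; the power 1/q is monotone on nonnegative
   extended reals. *)
suff le_q : (poweR (OT L q (uniform_square e0) (@mzero _ (R * R)%type R)) q <=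
    poweR (3 * e)%:E q)%E.
  have qV0 : 0 <= q^-1 by rewrite invr_ge0 ltW.
  have poweRK x : (0 <= x)%E -> poweR (poweR x q) q^-1 = x.
    by move=> x0; rewrite -poweRrM mulfV ?gt_eqF// poweRe1.
  rewrite -[leLHS]poweRK ?poweR_ge0// -[leRHS]poweRK ?lee_fin//.
  apply: gt0_ler_poweR => //;
    by rewrite in_itv/= leey ?lee_fin ?powR_ge0 ?poweR_ge0.
apply: (le_trans (poweR_OT_le q0 is_intensity_uniform_square
  (is_intensity_mzero L))).
apply: (@le_trans _ _ (\int[lebesgue2]_(x in Omega L)
    (((3 * e) `^ q)%:E * (square_pdf x)%:E))%E).
  apply: ge0_le_integral => //.
  - exact: measurable_Omega.
  - by move=> x _; rewrite lee_fin mulr_ge0// powR_ge0.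
  - apply/measurable_EFinP; apply: measurable_funTS; apply: measurable_funM.
      apply: measurableT_comp => //; apply: measurable_funB => //.
      exact: measurable_square_pdf.
    exact: measurable_dist2_diag_proj.
  - apply/measurable_EFinP; apply: measurable_funTS.
    apply: measurable_funM => //.
    exact: measurable_square_pdf.
  - move=> x _; rewrite -EFinM lee_fin subr0 ger0_norm ?square_pdf_ge0// mulrC.
    (* Off the square the density vanishes; on it the distance to the projection is at most 3e. *)
    have [xS|xS] := pselect (square x); last first.
      by rewrite /square_pdf indicE memNset// !mulr0.
    rewrite ler_wpM2r ?square_pdf_ge0//.
    rewrite ge0_ler_powR ?nnegrE ?sqrtr_ge0 ?(ltW q0)//.
    exact: square_dist2.
rewrite ge0_integralZl//; last 4 first.
- exact: measurable_Omega.
- apply/measurable_EFinP; apply: measurable_funTS.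
  exact: measurable_square_pdf.
- by move=> x _; rewrite lee_fin square_pdf_ge0.
- by rewrite lee_fin powR_ge0.
rewrite -[leRHS]mule1 lee_wpmul2l//= ?lee_fin ?powR_ge0//.
rewrite -uniform_square_setT; apply: ge0_subset_integral => //.
- exact: measurable_Omega.
- by apply/measurable_EFinP; exact: measurable_square_pdf.
- by move=> x _; rewrite lee_fin square_pdf_ge0.
Qed.

(** The sup norm is pointwise whereas intensities are determined only almost everywhere, so
    arbitrary versions are considered. The argument integrates over the square, where the masses are
    1 and 0. *)
Lemma sup_norm_ge_uniform_square (rmu rnu : R * R -> R) :
  is_intensity L (uniform_square e0) rmu ->
  is_intensity L (@mzero _ (R * R)%type R) rnu ->
  ((e ^- 2)%:E <= sup_norm L (fun x => (rmu x - rnu x)%R))%E.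
Proof.
move=> [rmu0 mrmu rmuE] [rnu0 mrnu rnuE].
have mS := measurable_square.
have SO := square_Omega.
have mO := measurable_Omega L.
have L0 : 0 < L by have [e0' eL'] := (e0, eL); lra.
have mrmuS : measurable_fun square (fun x => (rmu x)%:E).
  by apply/measurable_EFinP; exact: measurable_funS mrmu.
have mrnuS : measurable_fun square (fun x => (rnu x)%:E).
  by apply/measurable_EFinP; exact: measurable_funS mrnu.
have rmu1 : (\int[lebesgue2]_(x in square) (rmu x)%:E = 1)%E.
  rewrite -ge0_integral_lebesgue2//; last by move=> x /SO/rmu0; rewrite lee_fin.
  by rewrite -rmuE//; exact: uniform_square_square.
have rnu_square0 : (\int[lebesgue2]_(x in square) (rnu x)%:E = 0)%E.
  rewrite -ge0_integral_lebesgue2//; last by move=> x /SO/rnu0; rewrite lee_fin.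
  by rewrite -rnuE.
have := sup_norm_ge0 (fun x => rmu x - rnu x) L0.
have := @sup_norm_ubound R L (fun x => rmu x - rnu x).
case: (sup_norm _ _) => [S|_ _|//]; last by rewrite leey.
move=> le_S S0; rewrite lee_fin.
(* On the square [rmu] is at most S + [rnu]; as [rnu] has integral 0 there, 1 <= S e^2 follows. *)
have : (1 <= \int[lebesgue2]_(x in square) (S%:E + (rnu x)%:E))%E.
  rewrite -rmu1; apply: ge0_le_integral => //.
  - by move=> x /SO/rmu0; rewrite lee_fin.
  - exact: emeasurable_funD.
  - move=> x /SO xO; rewrite -EFinD lee_fin -lerBlDr (le_trans (ler_norm _))//.
    by rewrite -lee_fin; exact: le_S.
rewrite ge0_integralD//; last by move=> x /SO/rnu0; rewrite lee_fin.
rewrite rnu_square0 adde0 integral_cst//= lebesgue2_square -EFinM lee_fin => Se.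
by rewrite -[leLHS]mul1r ler_pdivrMr// exprn_gt0.
Qed.

End uniform_square.

(** * Side lengths tending to zero *)

Section shrinking_squares.
Context {R : realType}.
Variables (L : R) (L0 : 0 < L).

(** [harmonic n] is 1/(n+1), so the bound L/8 required of the side holds from n = 0 on. *)
Definition side (n : nat) : R := L / 8 * harmonic n.

Lemma side_gt0 n : 0 < side n.
Proof. by rewrite mulr_gt0 ?divr_gt0// invr_gt0. Qed.

Lemma side_le n : side n <= L / 8.
Proof.
by rewrite ler_piMr ?divr_ge0 ?(ltW L0)// invf_le1// ler1n.
Qed.

Lemma cvg_side : side n @[n --> \oo] --> 0.
Proof.
by rewrite -[X in _ --> X](mulr0 (L / 8)); apply: cvgMr; exact: cvg_harmonic.
Qed.

End shrinking_squares.

Theorem theorem2p1 (R : realType) (L q : R) (hL : 0 < L) (hq : 0 < q) :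
  (forall (mu nu : {measure set (R * R) -> \bar R}) (pmu pnu : R * R -> R),
     expected_persistence_measure L mu ->
     expected_persistence_measure L nu ->
     is_intensity L mu pmu ->
     is_intensity L nu pnu ->
     (poweR (OT L q mu nu) q <=
        (2 / ((q + 1) * (q + 2)) * (L / Num.sqrt 2) `^ (q + 2))%:E *
        sup_norm L (fun x => (pmu x - pnu x)%R))%E)
  /\
  (exists (mu nu : nat -> {measure set (R * R) -> \bar R})
          (pmu pnu : nat -> R * R -> R),
     [/\ forall n : nat,
           [/\ expected_persistence_measure L (mu n) /\
               expected_persistence_measure L (nu n),
               radon_on_Omega L (mu n) /\ radon_on_Omega L (nu n),
               is_intensity L (mu n) (pmu n) /\
               is_intensity L (nu n) (pnu n) &
               (sup_norm L (fun x => (pmu n x - pnu n x)%R) < +oo)%E],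
         OT L q (mu n) (nu n) @[n --> \oo] --> 0%E &
          forall rmu rnu : nat -> R * R -> R,
           (forall n : nat, is_intensity L (mu n) (rmu n) /\
                            is_intensity L (nu n) (rnu n)) ->
           sup_norm L (fun x => rmu n x - rnu n x) @[n --> \oo] --> +oo%E]).
Proof.
split=> [mu nu pmu pnu _ _ mup nup|]; first exact: poweR_OT_le_sup_norm.
pose e := side L.
have e0 : forall n, 0 < e n := side_gt0 hL.
have eL : forall n, e n <= L / 8 := side_le hL.
exists (fun n => uniform_square L (e0 n)), (fun=> @mzero _ (R * R)%type R),
  (fun n => square_pdf L (e n)), (fun=> cst 0).
split.
- move=> n; split.
  + split; last exact: expected_persistence_measure_mzero.
    apply: expected_persistence_measure_probability.
    exact: uniform_square_OmegaC.
  + split; [exact: radon_on_Omega_uniform_square|].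
    exact: radon_on_Omega_mzero.
  + by split; [exact: is_intensity_uniform_square|exact: is_intensity_mzero].
  + by apply: le_lt_trans (sup_norm_square_pdf _ _) _; rewrite ltry.
- apply: (@squeeze_cvge _ _ _ _ (cst 0%E) _ (fun n => (3 * e n)%:E)).
  + by near=> n; rewrite poweR_ge0 OT_uniform_square.
  + exact: cvg_cst.
  + apply: cvg_EFin; first by near=> n.
    by rewrite -[X in _ --> X](mulr0 3); apply: cvgMr; exact: cvg_side.
- move=> rmu rnu rP.
  apply: (@squeeze_cvge _ _ _ _ (fun n => (e n ^- 2)%:E) _ (cst +oo%E)).
  + near=> n; rewrite leey andbT; have [rmuP rnuP] := rP n.
    exact: sup_norm_ge_uniform_square rmuP rnuP.
  (* A positive sequence tends to +oo exactly when its inverse, here e_n^2, tends to 0. *)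
  + apply/cvgeryP/gtr0_cvgV0; first by near=> n; rewrite invr_gt0 exprn_gt0.
    have e2 : e n ^+ 2 @[n --> \oo] --> 0.
      by rewrite -[X in _ --> X](mulr0 0); apply: cvgM; exact: cvg_side.
    by apply: cvg_trans e2; apply: near_eq_cvg; near=> n; rewrite /= invrK.
  + exact: cvg_cst.
Unshelve. all: by end_near. Qed.
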